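(* Let $r\ge 2$ and $d\ge 1$. The map $det^{S^r}$ has the property that $det^{S^r}((v_{i_1,\ldots,i_r})_{1\leq i_1<i_2<\ldots<i_r\leq rd})=0$ if there exist $1\leq x_1<x_2<\ldots<x_{r+1}\leq rd$ such that $$v_{x_1,x_2,\ldots,x_r}=v_{x_1,\ldots,x_{r-1},x_{r+1}}=v_{x_1,\ldots,x_{r-2},x_r,x_{r+1}}=\ldots=v_{x_1,x_3,\ldots,x_r,x_{r+1}}=v_{x_2,x_3,\ldots,x_{r+1}},$$ i.e. such that the $r+1$ vectors indexed by the $r$-element subsets of $\{x_1,\dots,x_{r+1}\}$ are all equal.
   Context: $k$ is a field of characteristic zero, and $V_d$ is a $k$-vector space of dimension $d$ with basis $\{e_1,\dots,e_d\}$. Definition of $det^{S^r}$ ($r\ge 2$). Given $v_{i_1,\dots,i_r}\in V_d$ for $1\leq i_1<\dots<i_r\leq rd$, for each $1\leq m_1<\dots<m_{r-1}\leq rd$ let $\mathcal{E}_{m_1,\dots,m_{r-1}}$ be the vector equation (with scalar unknowns $\lambda_{i_1,\dots,i_r}$) $$\sum_{j=0}^{r-1}\ \sum_{m_j<s<m_{j+1}}(-1)^{(s-1)+j}\lambda_{m_1,\dots,m_j,s,m_{j+1},\dots,m_{r-1}}\,v_{m_1,\dots,m_j,s,m_{j+1},\dots,m_{r-1}}=0,$$ where $m_0=0$ and $m_r=rd+1$. In the basis $e_1,\dots,e_d$ each such equation is a block of $d$ scalar linear equations. Let $A_{rd}((v_{i_1,\dots,i_r}))$ be the $d\binom{rd-1}{r-1}\times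 d\binom{rd-1}{r-1}$ coefficient matrix of the system of the equations $\mathcal{E}_{m_1,\dots,m_{r-1}}$ with $1\leq m_1<\dots<m_{r-1}<rd$ (columns indexed by $(i_1,\dots,i_r)$, row blocks by $(m_1,\dots,m_{r-1})$, in lexicographic order). The multilinear map $det^{S^r}:V_d^{\binom{rd}{r}}\to k$ is defined by $det^{S^r}((v_{i_1,\dots,i_r})_{1\leq i_1<\dots<i_r\leq rd})=\det(A_{rd}((v_{i_1,\dots,i_r})))$. *)

(* Defs.v *)
From HB Require Import structures.
From mathcomp Require Import all_boot all_order all_algebra.

Set Implicit Arguments.
Unset Strict Implicit.
Unset Printing Implicit Defensive.

Import Order.TTheory GRing.Theory.
Local Open Scope ring_scope.

(* The multi-indices 1 <= i_1 < ... < i_r <= n, stored as 0-based ordinals and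
   ordered lexicographically (the order of tuplelexi). *)
Definition incr (r n : nat) :=
  {t : r.-tuplelexi 'I_n | sorted ltn (map val t)}.

HB.instance Definition _ (r n : nat) := SubFinite.on (incr r n).
HB.instance Definition _ (r n : nat) :=
  [SubChoice_isSubOrder of incr r n by <: with
     Order.seqlexi_display Order.OrdinalOrder.ord_display].

(* The 1-based list [:: i_1; ...; i_r]. *)
Definition entries (r n : nat) (i : incr r n) : seq nat :=
  [seq (nat_of_ord x).+1 | x <- val i].

Lemma card_incr (r n : nat) : #|{: incr r n}| = 'C(n, r).
Proof.
rewrite -card_ltn_sorted_tuples card_sig.
by apply: eq_card => t; rewrite !inE.
Qed.

(* The multi-indices 1 <= m_1 < ... < m_p < n. *)
Definition row_idx (p n : nat) : {set incr p n} :=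
  [set m | all (fun x => x < n)%N (entries m)].

Lemma card_row_idx (p N : nat) : #|row_idx p N| = 'C(N.-1, p).
Proof.
rewrite -card_ltn_sorted_tuples.
pose f (t : p.-tuple 'I_N.-1) : p.-tuple 'I_N :=
  map_tuple (widen_ord (leq_pred N)) t.
have val_f t : map val (f t) = map val t by rewrite -map_comp.
have f_inj : injective f.
  by move=> t u /(congr1 (map val \o val)) /=;
     rewrite !val_f => /(inj_map val_inj) /val_inj.
rewrite -(card_imset _ f_inj) -(card_image val_inj).
apply: eq_card => t; apply/imageP/imsetP => [[m Am ->]|[u]].
  have lt_m i : (tnth (val m) i < N.-1)%N.
    move: Am; rewrite inE /entries all_map => /allP /(_ _ (mem_tnth i (val m))).
    by rewrite /= ltn_predRL.
  pose u := [tuple Ordinal (lt_m i) | i < p].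
  have fu : f u = val m.
    by apply: eq_from_tnth => i; rewrite tnth_map tnth_mktuple; apply: val_inj.
  exists u => //; rewrite inE -val_f fu; exact: (valP m).
rewrite inE -val_f => u_sorted ->.
exists (Sub (f u : p.-tuplelexi 'I_N) u_sorted : incr p N); rewrite ?SubK //.
rewrite inE /entries SubK -map_comp all_map; apply/allP => x _ /=.
by rewrite -ltn_predRL.
Qed.

Section DetS.

Variables (k : fieldType) (V : vectType k) (r d : nat).

Local Notation n := (r * d)%N.

(* The left-hand side of E_m.  Since 0 :: entries m has size r, nth gives
   m_0 = 0, then m_1, ..., m_{r-1}, then m_r = n.+1.  The innermost sum has
   exactly one term, the multi-index obtained by inserting s into m. *)
Definition eqn_lhs (v : incr r n -> V) (lam : incr r n -> k)
    (m : incr r.-1 n) : V :=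
  let m_ := nth n.+1 (0%N :: entries m) in
  \sum_(j < r) \sum_((m_ j).+1 <= s < m_ j.+1)
    \sum_(i : incr r n |
            entries i == take j (entries m) ++ s :: drop j (entries m))
      ((-1) ^+ (s.-1 + j) * lam i) *: v i.

(* The coefficient of lambda_i in E_m is eqn_lhs at lambda = delta_i, and its
   coordinates in the basis e give one column of the block of d rows of E_m.
   Order.enum_val lists multi-indices in increasing lexicographic order. *)
Definition coef_blocks (e : d.-tuple V) (v : incr r n -> V) :
    'M[k]_((\sum_(b < #|row_idx r.-1 n|) d)%N, #|{: incr r n}|) :=
  \mxcol_(b < #|row_idx r.-1 n|)
    \matrix_(q < d, c < #|{: incr r n}|)
      coord e q (eqn_lhs v (fun i => (i == Order.enum_val c)%:R)
                           (Order.enum_val b)).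

Lemma coef_rows : (\sum_(b < #|row_idx r.-1 n|) d = d * 'C(n.-1, r.-1))%N.
Proof. by rewrite sum_nat_const card_ord card_row_idx mulnC. Qed.

Lemma coef_cols (hr : (1 < r)%N) : #|{: incr r n}| = (d * 'C(n.-1, r.-1))%N.
Proof.
have r_gt0 := ltnW hr.
apply/eqP; rewrite card_incr -(eqn_pmul2l r_gt0) mulnA mul_bin_diag.
by rewrite prednK.
Qed.

Definition A_mx (hr : (1 < r)%N) (e : d.-tuple V) (v : incr r n -> V) :
    'M[k]_(d * 'C(n.-1, r.-1))%N :=
  castmx (coef_rows, coef_cols hr) (coef_blocks e v).

Definition detS (hr : (1 < r)%N) (e : d.-tuple V) (v : incr r n -> V) : k :=
  \det (A_mx hr e v).

End DetS.

(* Main.v *)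
Require Import Defs.
From mathcomp Require Import all_boot all_order all_algebra.

Set Implicit Arguments.
Unset Strict Implicit.
Unset Printing Implicit Defensive.

Import GRing.Theory.
Local Open Scope ring_scope.

(* The matrix is singular because the system has an explicit nonzero solution.
   Let w be the common value of the vectors indexed by the r-subsets of x.
   Put lambda = (-1)^(x_p + p) on the subset x \ {x_p}, and 0 on multi-indices
   not contained in x.  Only equations E_m with m contained in x see a nonzero
   lambda; then x = m + {a, b} and E_m has just the two terms from s = a and
   s = b.  Both are multiples of w, with signs that differ only in whether
   [a < b] or [b < a] is counted, so they cancel. *)

(** * Multi-indices as strictly increasing lists *)

Lemma size_entries (r n : nat) (i : incr r n) : size (entries i) = r.
Proof. by rewrite size_map size_tuple. Qed.

Lemma sorted_entries (r n : nat) (i : incr r n) : sorted ltn (entries i).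
Proof.
have := valP i; rewrite /entries /= -[X in sorted _ X]map_id => si.
by rewrite (map_comp S val) sorted_map -[X in sorted _ X]map_id.
Qed.

Lemma uniq_entries (r n : nat) (i : incr r n) : uniq (entries i).
Proof. exact: (sorted_uniq ltn_trans ltnn (sorted_entries i)). Qed.

Lemma mem_entries_bound (r n : nat) (i : incr r n) (s : nat) :
  s \in entries i -> (0 < s < n.+1)%N.
Proof. by case/mapP => x _ ->; exact: ltn_ord. Qed.

(** A strictly increasing list is determined by its set of elements, so multi-indices can be
    compared without regard to order. *)
Lemma entries_inj (r n : nat) (i j : incr r n) :
  entries i =i entries j -> i = j.
Proof.
move/(irr_sorted_eq ltn_trans ltnn (sorted_entries i) (sorted_entries j)).
move=> eq_ij; apply/val_inj/val_inj.
by apply: inj_map eq_ij => x y [] /val_inj.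
Qed.

Lemma entries_surj (r n : nat) (l : seq nat) :
    uniq l -> size l = r -> {in l, forall s, (0 < s < n.+1)%N} ->
  exists i : incr r n, perm_eq (entries i) l.
Proof.
move=> l_uniq l_size l_bnd.
set l' := sort leq l.
have l'_perm : perm_eq l' l by rewrite perm_sort.
have l'_sorted : sorted ltn l'.
  by rewrite ltn_sorted_uniq_leq sort_uniq l_uniq sort_sorted.
have l'_bnd s : s \in l' -> (0 < s < n.+1)%N by rewrite mem_sort; exact: l_bnd.
(* The bounds put every predecessor below [n], so [pmap] drops nothing; positivity lets the
   successor in [entries] undo [predn]. *)
pose t : seq 'I_n := pmap insub (map predn l').
have val_t : map val t = map predn l'.
  rewrite (pmap_filter (insubK _)); apply/all_filterP.
  rewrite all_map; apply/allP => s /l'_bnd /=.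
  by case: s => //= s; rewrite ltnS isSome_insub.
have St : [seq (nat_of_ord x).+1 | x <- t] = l'.
  rewrite (map_comp S val) val_t -map_comp -[RHS]map_id.
  by apply/eq_in_map => -[|s] /l'_bnd.
have t_size : size t == r.
  by rewrite -(size_map (fun x => (nat_of_ord x).+1)) St size_sort l_size.
have t_sorted : sorted ltn (map val (Tuple t_size)).
  by move: l'_sorted; rewrite -St (map_comp S val) sorted_map.
exists (Sub (Tuple t_size : r.-tuplelexi 'I_n) t_sorted : incr r n).
by rewrite /entries SubK /= St.
Qed.

(** * Rewriting the equations without gaps *)

Lemma count_lt_path (a : nat) (m : seq nat) : path ltn a m ->
  count (ltn^~ a) m = 0%N.
Proof.
move=> /(order_path_min ltn_trans) /allP lt_a; apply/eqP; rewrite -leqn0 leqNgt.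
by rewrite -has_count; apply/hasPn => s /lt_a /ltnW; rewrite -leqNgt.
Qed.

(** The number of elements below [s] is the position where [s] belongs in an increasing list. *)
Lemma path_insert (a s : nat) (m : seq nat) :
    path ltn a m -> (a < s)%N -> s \notin m ->
  path ltn a (take (count (ltn^~ s) m) m ++ s :: drop (count (ltn^~ s) m) m).
Proof.
elim: m a => [|b m IH] a /=; first by move=> _ ->.
case/andP=> ab bm as_; rewrite inE negb_or => /andP[sb sm].
case: (ltnP b s) => bs /=; first by rewrite ab IH.
have lt_sb : (s < b)%N by rewrite ltn_neqAle sb.
have sm' : path ltn s m := path_le ltn_trans lt_sb bm.
by rewrite add0n (count_lt_path sm') /= as_ lt_sb.
Qed.

(** The gaps partition the values outside [m], and a value in gap number [j] has exactly [j]
    elements of [m] below it, so a count can replace the gap index. *)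
Lemma sum_gaps (W : nmodType) (F : nat -> nat -> W) (N a : nat) (m : seq nat) :
    path ltn a m -> (a < N)%N -> all (ltn^~ N) m ->
  \sum_(j < (size m).+1)
      \sum_((nth N (a :: m) j).+1 <= s < nth N (a :: m) j.+1) F j s =
  \sum_(a.+1 <= s < N | s \notin m) F (count (ltn^~ s) m) s.
Proof.
elim: m a F => [|b m IH] a F /=; first by move=> _ _ _; rewrite big_ord1.
case/andP=> ab bm aN /andP[bN mN].
have lt_b := allP (order_path_min ltn_trans bm).
(* The later gaps start at [b], which lies below all their values and adds one to each count; hence
   the shift in [F]. *)
rewrite big_ord_recl /= (IH b (fun j => F j.+1)) //.
rewrite [RHS](big_cat_nat (n := b)) ?(ltnW bN) //=.
rewrite big_nat [X in _ = X + _]big_nat_cond; congr (_ + _).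
  apply: eq_big => s.
    case: andP => //= -[_ sb]; rewrite inE negb_or neq_ltn sb /=.
    by apply/esym/negP => /lt_b /(ltn_trans sb); rewrite ltnn.
  move=> /andP[_ sb]; rewrite (ltnNge b) (ltnW sb) /= count_lt_path //.
  exact: (path_le ltn_trans sb bm).
rewrite [RHS]big_ltn_cond // mem_head /= big_nat_cond [RHS]big_nat_cond.
apply: eq_big => s; last by move=> /andP[/andP[bs _] _]; rewrite bs.
by rewrite inE negb_or neq_ltn; case: (b < s)%N; rewrite ?orbT.
Qed.

Lemma perm_insert (m : seq nat) (j s : nat) :
  perm_eq (take j m ++ s :: drop j m) (s :: m).
Proof. by rewrite perm_catC /= perm_cons perm_catC cat_take_drop. Qed.

(** Both lists are strictly increasing, so having the same elements suffices for equality; the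
    insertion position disappears from the index condition. *)
Lemma entries_insert (r n : nat) (i : incr r n) (m : seq nat) (s : nat) :
    sorted ltn m -> all (ltn 0) m -> (0 < s)%N -> s \notin m ->
    let j := count (ltn^~ s) m in
  (entries i == take j m ++ s :: drop j m) = perm_eq (entries i) (s :: m).
Proof.
move=> m_sorted m_gt0 s_gt0 sm j; apply/eqP/idP => [->|].
  exact: perm_insert.
rewrite -(permPr (perm_insert m j s)) => /perm_mem /irr_sorted_eq.
apply; [exact: ltn_trans | exact: ltnn | exact: sorted_entries |].
apply: (@path_sorted _ _ 0%N); apply: path_insert => //.
by rewrite path_sortedE ?m_gt0 //; exact: ltn_trans.
Qed.

(** Working form of the equations: the order of the entries survives only in the sign. *)
Lemma eqn_lhsE (k : fieldType) (V : vectType k) (r d : nat)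
    (v : incr r (r * d) -> V) (lam : incr r (r * d) -> k)
    (m : incr r.-1 (r * d)) : (0 < r)%N ->
  eqn_lhs v lam m =
  \sum_(1 <= s < (r * d).+1 | s \notin entries m)
    (-1) ^+ (s.-1 + count (ltn^~ s) (entries m)) *:
      \sum_(i | perm_eq (entries i) (s :: entries m)) lam i *: v i.
Proof.
move=> r_gt0; rewrite /eqn_lhs.
have m_gt0 : all (ltn 0) (entries m) by apply/allP => s /mem_entries_bound /andP[].
have m_path : path ltn 0 (entries m).
  by rewrite path_sortedE ?m_gt0 ?sorted_entries //; exact: ltn_trans.
have size_m : (size (entries m)).+1 = r by rewrite size_entries prednK.
pose F j s := \sum_(i : incr r (r * d) |
    entries i == take j (entries m) ++ s :: drop j (entries m))
      ((-1) ^+ (s.-1 + j) * lam i) *: v i.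
have := sum_gaps (N := (r * d).+1) F m_path isT.
rewrite size_m /F => ->; last by apply/allP => s /mem_entries_bound /andP[].
rewrite big_nat_cond [RHS]big_nat_cond; apply: eq_bigr => s /andP[/andP[s_gt0 _] sm].
rewrite scaler_sumr; apply: eq_big => i; last by rewrite scalerA.
by rewrite entries_insert ?sorted_entries.
Qed.

(** * From a nonzero solution to a vanishing determinant *)

(** The values at delta functions give the columns of the coefficient matrix, so this identifies its
    product with [lam] with the left-hand sides of the equations. *)
Lemma eqn_lhs_sum (k : fieldType) (V : vectType k) (r d : nat)
    (v : incr r (r * d) -> V) (lam : incr r (r * d) -> k)
    (m : incr r.-1 (r * d)) : (0 < r)%N ->
  eqn_lhs v lam m = \sum_i lam i *: eqn_lhs v (fun j => (j == i)%:R) m.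
Proof.
move=> r_gt0; under eq_bigr do rewrite eqn_lhsE // scaler_sumr.
rewrite eqn_lhsE // [RHS]exchange_big /=; apply: eq_bigr => s _.
under [RHS]eq_bigr do rewrite scalerA mulrC -scalerA scaler_sumr.
rewrite -[RHS]scaler_sumr; congr (_ *: _); rewrite [RHS]exchange_big /=.
apply: eq_bigr => i _; rewrite (bigD1 i) //= eqxx scale1r big1 ?addr0 // => j ne_ji.
by rewrite eq_sym (negPf ne_ji) scale0r scaler0.
Qed.

Lemma det_castmx_eq0 (k : fieldType) (p q N : nat) (ep : p = N) (eq : q = N)
    (B : 'M[k]_(p, q)) (w : 'cV_q) :
  w != 0 -> B *m w = 0 -> \det (castmx (ep, eq) B) = 0.
Proof.
case: N / ep eq B => eq; case: p / eq => B w_neq0 Bw.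
(* The criterion [det0P] asks for a row vector in the left kernel, hence the transpose. *)
rewrite castmx_id -det_tr; apply/eqP/det0P; exists w^T.
  by rewrite -trmx0 (inj_eq trmx_inj).
by rewrite -trmx_mul Bw trmx0.
Qed.

Lemma detS_eq0 (k : fieldType) (V : vectType k) (r d : nat) (hr : (1 < r)%N)
    (e : d.-tuple V) (v : incr r (r * d) -> V) (lam : incr r (r * d) -> k)
    (i0 : incr r (r * d)) :
  lam i0 != 0 -> (forall m, eqn_lhs v lam m = 0) -> detS hr e v = 0.
Proof.
move=> lam_neq0 lamP.
apply: (@det_castmx_eq0 _ _ _ _ _ _ _ (\col_c lam (Order.enum_val c))).
  apply/eqP => /colP /(_ (Order.enum_rank i0)) /eqP.
  by rewrite !mxE Order.enum_rankK (negPf lam_neq0).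
rewrite mxcol_mul -[RHS]mxcol0; apply/eq_mxcol => b; apply/colP => q.
rewrite !mxE -[RHS](linear0 (coord e q)) -(lamP (Order.enum_val b)).
rewrite eqn_lhs_sum ?(ltnW hr) // linear_sum /=.
rewrite [RHS](reindex _ (onW_bij _ (Order.enum_val_bij _))) /=.
by apply: eq_bigr => c _; rewrite !mxE linearZ /= mulrC.
Qed.

(** * Signs and the kernel vector *)

(** Positivity gives [a.-1 + b = a + b.-1], and exactly one of [a < b] and [b < a] holds, so the two
    total exponents have opposite parity. *)
Lemma sign_cancel (k : fieldType) (V : lmodType k) (a b ca cb : nat) (w : V) :
    (0 < a)%N -> (0 < b)%N -> a != b ->
  (-1) ^+ (a.-1 + ca) *: ((-1) ^+ (b + ((a < b) + cb)) *: w) +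
  (-1) ^+ (b.-1 + cb) *: ((-1) ^+ (a + ((b < a) + ca)) *: w) = 0.
Proof.
case: a b => [|a] [|b] // _ _ ne_ab; rewrite /= !scalerA -!exprD -scalerDl.
rewrite -signr_odd -[X in _ + X]signr_odd !oddD /= !oddb.
have -> : (b.+1 < a.+1)%N = ~~ (a.+1 < b.+1)%N.
  by rewrite -leqNgt [RHS]leq_eqVlt eq_sym (negPf ne_ab).
case: (odd a); case: (odd b); case: (odd ca); case: (odd cb); case: (_ < _)%N;
  by rewrite /= ?expr0 ?expr1 ?addNr ?addrN ?scale0r.
Qed.

(* If i is x with its entry p removed, the sum has the single term
   (-1)^(p + #{entries of x below p}); this is the kernel vector. *)
Definition face_sign (k : fieldType) (n r : nat)
    (x : incr r.+1 n) (i : incr r n) : k :=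
  if all (mem (entries x)) (entries i)
  then \sum_(p <- entries x | p \notin entries i)
         (-1) ^+ (p + count (ltn^~ p) (entries x))
  else 0.

Lemma face_sign_perm (k : fieldType) (n r : nat) (x : incr r.+1 n) (i : incr r n)
    (p : nat) :
  perm_eq (entries x) (p :: entries i) ->
  face_sign k x i = (-1) ^+ (p + count (ltn^~ p) (entries x)).
Proof.
move=> x_pi; rewrite /face_sign ifT; last first.
  by apply/allP => s si; rewrite /= (perm_mem x_pi) inE si orbT.
have pi : p \notin entries i.
  by have := uniq_entries x; rewrite (perm_uniq x_pi) => /andP[].
rewrite (perm_big _ x_pi) big_cons pi /= big_seq_cond big_pred0 ?addr0 // => s.
by rewrite andbN.
Qed.

(** The only index in the sum is [x] with [t] removed. The entries of [x] below [t] are those of [m]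
    below [t], together with [s] when [s < t]. *)
Lemma sum_insert (k : fieldType) (V : vectType k) (r n : nat)
    (v : incr r n -> V) (w : V) (x : incr r.+1 n)
    (hw : forall i, {subset entries i <= entries x} -> v i = w)
    (s t : nat) (m : seq nat) :
  perm_eq (entries x) [:: t, s & m] ->
  \sum_(i | perm_eq (entries i) (s :: m)) face_sign k x i *: v i =
  (-1) ^+ (t + ((s < t) + count (ltn^~ t) m)) *: w.
Proof.
move=> x_ts.
have sub_x : {subset s :: m <= entries x}.
  by move=> y ym; rewrite (perm_mem x_ts) inE ym orbT.
have [||y /sub_x /mem_entries_bound //|i i_sm] := @entries_surj r n (s :: m).
- by have := uniq_entries x; rewrite (perm_uniq x_ts) => /andP[].
- by have := perm_size x_ts; rewrite size_entries => -[].
rewrite (big_pred1 i) => [|j /=]; last first.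
  apply/idP/eqP => [j_sm|-> //]; apply: entries_inj => y.
  by rewrite (perm_mem i_sm) (perm_mem j_sm).
rewrite hw => [|y]; last by rewrite (perm_mem i_sm); exact: sub_x.
rewrite (@face_sign_perm _ _ _ _ _ t).
  by rewrite (permP x_ts) /= ltnn.
by rewrite (permPl x_ts) perm_cons perm_sym.
Qed.

Lemma eqn_lhs_face_sign (k : fieldType) (V : vectType k) (r d : nat)
    (v : incr r (r * d) -> V) (w : V) (x : incr r.+1 (r * d))
    (hw : forall i, {subset entries i <= entries x} -> v i = w)
    (m : incr r.-1 (r * d)) :
  (0 < r)%N -> eqn_lhs v (face_sign k x) m = 0.
Proof.
move=> r_gt0; rewrite eqn_lhsE //.
have lam0 s : ~ {subset s :: entries m <= entries x} ->
    \sum_(i | perm_eq (entries i) (s :: entries m)) face_sign k x i *: v i = 0.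
  move=> sm; apply: big1 => i i_sm; rewrite /face_sign ifN ?scale0r //.
  by rewrite (perm_all _ i_sm); apply/negP => /allP.
(* If [m] is not contained in [x], neither is any [s :: entries m], and every term vanishes. *)
have [/allP mx|/allP mx] := boolP (all (mem (entries x)) (entries m)); last first.
  rewrite big1 // => s _; rewrite lam0 ?scaler0 // => smx; apply: mx => y ym.
  by apply: smx; rewrite inE ym orbT.
rewrite (bigID (mem (entries x))) /= [X in _ + X]big1 ?addr0; last first.
  move=> s /andP[_ sx]; rewrite lam0 ?scaler0 //.
  by move=> /(_ s (mem_head _ _)); apply/negP.
under eq_bigl do rewrite andbC.
rewrite -big_filter_cond.
rewrite (@perm_big _ _ _ _ _ (entries x)); last first.
  apply: uniq_perm => [||y]; rewrite ?filter_uniq ?iota_uniq ?uniq_entries //.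
  rewrite mem_filter mem_index_iota andbC.
  by case: (boolP (y \in _)) => [/mem_entries_bound ->|]; rewrite ?andbF.
rewrite -big_filter.
(* The surviving values of [s]; there are (r+1) - (r-1) = 2 of them, the [a] and [b] below. *)
set c := [seq s <- entries x | s \notin entries m].
have c_perm : perm_eq (entries x) (c ++ entries m).
  apply: uniq_perm => [||y]; rewrite ?uniq_entries //.
    rewrite cat_uniq filter_uniq ?uniq_entries // andbT /=.
    by apply/hasPn => y ym; rewrite /= mem_filter ym.
  rewrite mem_cat mem_filter; case: (boolP (y \in entries m)) => [ym|_] /=; first exact: mx.
  by rewrite orbF.
have c_size : size c = 2%N.
  have := perm_size c_perm; rewrite size_cat !size_entries.
  by rewrite -{1}(prednK r_gt0) -[_.+2]/(2 + _)%N => /addIn.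
case: c c_size c_perm => [|a [|b [|]]] // _ x_ab.
have x_ba : perm_eq (entries x) [:: b, a & entries m].
  by rewrite (permPl x_ab) (perm_catCA [:: a] [:: b]).
rewrite big_cons big_seq1 (sum_insert hw x_ba) (sum_insert hw x_ab).
have /= := uniq_entries x; rewrite (perm_uniq x_ab) /= inE negb_or.
case/andP=> /andP[ne_ab _] _; apply: sign_cancel ne_ab.
  have : a \in entries x by rewrite (perm_mem x_ab) mem_head.
  by case/mem_entries_bound/andP.
have : b \in entries x by rewrite (perm_mem x_ba) mem_head.
by case/mem_entries_bound/andP.
Qed.

Theorem lemma5p5 (k : fieldType) (hk : [pchar k] =i pred0)
    (r d : nat) (hr : (1 < r)%N) (hd : (0 < d)%N)
    (V : vectType k) (e : d.-tuple V) (he : basis_of fullv e)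
    (v : incr r (r * d) -> V)
    (hv : exists x : incr r.+1 (r * d),
        forall i j : incr r (r * d),
          {subset entries i <= entries x} ->
          {subset entries j <= entries x} -> v i = v j) :
  detS hr e v = 0.
Proof.
case: hv => x hx.
(* Removing the smallest entry [p] of [x] gives an index [i] at which the kernel vector is a sign,
   hence nonzero; [v i] then serves as the common vector. *)
case def_x: (entries x) (uniq_entries x) (size_entries x) => [//|p l].
move=> /andP[_ l_uniq] [l_size].
have lx : {subset l <= entries x} by move=> s sl; rewrite def_x inE sl orbT.
have [s /lx /mem_entries_bound //|i i_l] :=
  @entries_surj r (r * d) l l_uniq l_size.
have ix : {subset entries i <= entries x} by move=> s; rewrite (perm_mem i_l); exact: lx.
apply: (@detS_eq0 _ _ _ _ _ _ _ (face_sign k x) i) => [|m].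
  by rewrite (@face_sign_perm _ _ _ _ _ p) ?signr_eq0 // def_x perm_cons perm_sym.
apply: (@eqn_lhs_face_sign _ _ _ _ _ (v i)) (ltnW hr) => j jx; exact: hx.
Qed.
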